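(* For three agents the partition-based strategy is optimal: for any maximum speeds $v_1, v_2, v_3 > 0$ and any $l > (v_1 + v_2 + v_3)/2$, no strategy for three agents with maximum speeds $v_1, v_2, v_3$ patrols the fence $[0, l]$.
   Context: Fence patrolling: a fence is a segment $[0,l]$ with $l>0$. There are $k$ agents $a_1,\dots,a_k$ with given maximum speeds $v_1,\dots,v_k>0$. The motion of agent $a_i$ is a function $a_i\colon[0,\infty)\to[0,l]$ satisfying $|a_i(t)-a_i(t+\epsilon)|\le v_i\epsilon$ for all $t\ge 0$, $\epsilon>0$. Agents may move in both directions and may pass each other. A strategy is a $k$-tuple $(a_1,\dots,a_k)$ of such functions. Agent $a_i$ covers the pair $(x;t^* )$ if $a_i(t)=x$ for some $t\in[t^*-1,t^* )$. A strategy patrols $[0,l]$ if for every $x\in[0,l]$ and every $t^*\in[1,\infty)$ some agent $a_i$ covers $(x;t^* )$. The partition-based strategy splits $[0,l]$ into $k$ consecutive segments of lengths proportional to $v_1,\dots,v_k$, with agent $a_i$ moving back and forth at full speed between the endpoints of the $i$-th segment; it patrols a fence of length $(v_1+\dots+v_k)/2$. *)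

(* Defs.v *)
From Stdlib Require Import Reals Lra.
Open Scope R_scope.

Definition motion (l v : R) (a : R -> R) : Prop :=
  (forall t, 0 <= t -> 0 <= a t <= l) /\
  (forall t eps, 0 <= t -> 0 < eps -> Rabs (a t - a (t + eps)) <= v * eps).

Definition covers (a : R -> R) (x tstar : R) : Prop :=
  exists t, tstar - 1 <= t < tstar /\ a t = x.

Definition strategy (k : nat) (l : R) (v : nat -> R) (a : nat -> R -> R) : Prop :=
  forall i, (i < k)%nat -> motion l (v i) (a i).

Definition patrols (k : nat) (l : R) (a : nat -> R -> R) : Prop :=
  forall x tstar, 0 <= x <= l -> 1 <= tstar ->
    exists i, (i < k)%nat /\ covers (a i) x tstar.

(* Main.v *)
Require Import Defs.
From Stdlib Require Import Reals Lra Lia Classical List.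
From Coquelicot Require Import Rcomplements.
Import ListNotations.
Open Scope R_scope.

(** Let f be the speed of the fastest agent F and g >= m those of G and M, and
    suppose that a fence of length L > (f + g + m) / 2 is patrolled.
    - G and M cannot both visit the same end within a unit of time, since some
      point at distance more than f / 2 from the other end would then be
      neglected. So while F is away from an end, a single slow agent guards it,
      and by the two-agent case F must keep visiting both ends.
    - When F travels from one end to the other, the agent guarding the end it
      left cannot also guard the end it is heading to, because
      L / f + L / v > 2 for v = g and v = m. So one slow agent guards each end.
    - Suppose that, during an excursion of F from x0 to x1 and back, M guards x0
      and G guards x1. Some point slightly more than m / 2 away from x0 must then
      be visited by G, so F has to stay near x1 long enough to replace G; the
      time this takes leaves another point unvisited.
    - Hence G guards x0 and M guards x1, and by symmetry M guards x0 and G guards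
      x1 during the next excursion of F, from x1 to x0 and back. The two
      excursions share the trip from x1 to x0, when x1 is left alone. *)

Lemma lt_div_add_div c x y a b :
  0 < a -> 0 < b -> c * (a * b) < x * b + y * a -> c < x / a + y / b.
Proof.
  intros Ha Hb H.
  replace (x / a + y / b) with ((x * b + y * a) / (a * b)) by (field; lra).
  apply Rlt_div_r; [nra | exact H].
Qed.

Lemma half_sum_lt_travel_times {a b d} :
  0 < a -> 0 < b -> (a + b) / 2 < d -> 2 < d / a + d / b.
Proof.
  intros Ha Hb Hd. apply lt_div_add_div; [exact Ha | exact Hb |].
  pose proof (pow2_ge_0 (a - b)). nra.
Qed.

Definition between (x0 x1 x : R) : Prop := x0 <= x <= x1 \/ x1 <= x <= x0.

Lemma between_sym x0 x1 x : between x0 x1 x -> between x1 x0 x.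
Proof. unfold between. tauto. Qed.

Lemma between_start x0 x1 : between x0 x1 x0.
Proof. unfold between. lra. Qed.

Lemma between_end x0 x1 : between x0 x1 x1.
Proof. unfold between. lra. Qed.

#[local] Hint Resolve between_start between_end : core.

Lemma between_at_distance x0 x1 d :
  0 <= d <= Rabs (x1 - x0) ->
  exists y, between x0 x1 y /\
    Rabs (y - x0) = d /\ Rabs (x1 - y) = Rabs (x1 - x0) - d.
Proof.
  intros Hd. destruct (Rle_lt_dec x0 x1); [exists (x0 + d) | exists (x0 - d)];
    unfold between; split_Rabs; lra.
Qed.

Lemma between_subsegment {x0 x1 y x} :
  between x0 x1 y -> between y x1 x ->
  between x0 x1 x /\ Rabs (y - x0) <= Rabs (x - x0).
Proof.
  unfold between. intros [H | H] [K | K]; split_Rabs; lra.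
Qed.

Record agent : Type := {
  position :> R -> R;
  speed : R;
  speed_pos : 0 < speed;
  speed_limit : forall s t,
    Rabs (position s - position t) <= speed * Rabs (s - t) }.

Implicit Types (a b F G M : agent) (agents : list agent).

Definition avoids (a : agent) (x S T : R) : Prop := forall w, S < w < T -> a w <> x.

Lemma avoids_subinterval a x S T S' T' :
  S <= S' -> T' <= T -> avoids a x S T -> avoids a x S' T'.
Proof. intros HS HT H w Hw. apply H. lra. Qed.

Lemma avoids_overlap {a x S T S' T'} :
  avoids a x S T -> avoids a x S' T' -> S' < T -> avoids a x S T'.
Proof.
  intros H H' Hlt w Hw. destruct (Rlt_le_dec w T); [apply H | apply H']; lra.
Qed.

Lemma avoids_distant a x y d w :
  a w = x -> d <= Rabs (y - x) -> avoids a y (w - d / speed a) (w + d / speed a).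
Proof.
  intros <- Hd s Hs <-.
  pose proof (speed_pos a). pose proof (speed_limit a s w).
  assert (Hlt : Rabs (s - w) < d / speed a) by (split_Rabs; lra).
  apply Rlt_div_r in Hlt; lra.
Qed.

Lemma last_visit a x t u :
  t <= u -> a t = x ->
  exists s, t <= s <= u /\ a s = x /\ forall w, s < w <= u -> a w <> x.
Proof.
  intros Htu Hat.
  destruct (completeness (fun s => t <= s <= u /\ a s = x)) as [s [Hub Hlub]].
  - exists u. intros s [H _]. lra.
  - exists t. split; [lra | exact Hat].
  - assert (Hts : t <= s) by (apply Hub; split; [lra | exact Hat]).
    assert (Hsu : s <= u) by (apply Hlub; intros w [H _]; lra).
    exists s. split; [lra |]. split.
    + apply NNPP. intros Hne.
      set (r := Rabs (x - a s) / speed a).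
      assert (Hr : 0 < r)
        by (apply Rdiv_lt_0_compat; [apply Rabs_pos_lt; lra | apply speed_pos]).
      assert (Haway : avoids a x (s - r) (s + r))
        by (apply (avoids_distant a (a s)); lra).
      assert (s <= s - r); [| lra].
      apply Hlub. intros w Hw. apply Rnot_lt_le. intros Hlt.
      apply (Haway w); [| apply Hw]. specialize (Hub w Hw). lra.
    + intros w Hw Haw. assert (w <= s); [| lra].
      apply Hub. split; [lra | exact Haw].
Qed.

Lemma time_reversal_limit a s t : Rabs (a (- s) - a (- t)) <= speed a * Rabs (s - t).
Proof.
  replace (Rabs (s - t)) with (Rabs (- s - - t)) by (split_Rabs; lra).
  apply speed_limit.
Qed.

Definition time_reversal (a : agent) : agent :=
  {| position := fun t => a (- t); speed := speed a; speed_pos := speed_pos a;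
     speed_limit := time_reversal_limit a |}.

Lemma first_visit a x t u :
  t <= u -> a u = x ->
  exists s, t <= s <= u /\ a s = x /\ forall w, t <= w < s -> a w <> x.
Proof.
  intros Htu Hau.
  destruct (last_visit (time_reversal a) x (- u) (- t)) as [s [Hs [Has Hlast]]];
    simpl in *; [lra | rewrite Ropp_involutive; exact Hau |].
  exists (- s). split; [lra |]. split; [exact Has |].
  intros w Hw. rewrite <- (Ropp_involutive w). apply Hlast. lra.
Qed.

Record transit (a : agent) (x y t u : R) : Prop := {
  transit_lt : t < u;
  transit_start : a t = x;
  transit_end : a u = y;
  transit_leaves : avoids a x t u;
  transit_arrives : avoids a y t u }.

Lemma transit_exists a x y t u :
  t <= u -> a t = x -> a u = y -> x <> y ->
  exists t' u', transit a x y t' u' /\ t <= t' /\ u' <= u.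
Proof.
  intros Htu Hat Hau Hxy.
  destruct (first_visit a y t u Htu Hau) as [u' [Hu' [Hau' Hfirst]]].
  destruct (last_visit a x t u') as [t' [Ht' [Hat' Hlast]]]; [lra | exact Hat |].
  assert (t' <> u') by congruence.
  exists t', u'. split; [| lra].
  constructor; auto; [lra | |]; intros w Hw; [apply Hlast | apply Hfirst]; lra.
Qed.

Lemma transit_duration {a x y t u} :
  transit a x y t u -> t + Rabs (y - x) / speed a <= u.
Proof.
  intros [Hlt Hat Hau _ _]. apply Rnot_lt_le. intros Hu.
  apply (avoids_distant a x y (Rabs (y - x)) t) with u; auto; lra.
Qed.

Lemma transit_avoids_start {a x y t u} :
  transit a x y t u -> x <> y -> avoids a x t (u + Rabs (y - x) / speed a).
Proof.
  intros [Hlt Hat Hau Hx Hy] Hxy.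
  assert (0 < Rabs (y - x) / speed a)
    by (apply Rdiv_lt_0_compat; [apply Rabs_pos_lt; lra | apply speed_pos]).
  apply (avoids_overlap (S' := u - Rabs (y - x) / speed a) Hx); [| lra].
  apply (avoids_distant a y); [exact Hau | rewrite Rabs_minus_sym; apply Rle_refl].
Qed.

Lemma transit_avoids_end {a x y t u} :
  transit a x y t u -> x <> y -> avoids a y (t - Rabs (y - x) / speed a) u.
Proof.
  intros [Hlt Hat Hau Hx Hy] Hxy.
  assert (0 < Rabs (y - x) / speed a)
    by (apply Rdiv_lt_0_compat; [apply Rabs_pos_lt; lra | apply speed_pos]).
  refine (avoids_overlap (T := t + Rabs (y - x) / speed a) _ Hy _); [| lra].
  apply (avoids_distant a x); [exact Hat | apply Rle_refl].
Qed.

(* The bound [S < u - 1] is strict to make the visit fall within the open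
   interval of [avoids]. *)
Definition attended (agents : list agent) (x S T : R) : Prop :=
  forall u, S < u - 1 -> u <= T ->
    exists w, u - 1 <= w < u /\ exists a, In a agents /\ a w = x.

Lemma attended_incl agents agents' x S T :
  incl agents agents' -> attended agents x S T -> attended agents' x S T.
Proof.
  intros Hincl H u HS HT. destruct (H u HS HT) as [w [Hw [a [Ha E]]]].
  exists w. split; [exact Hw |]. exists a. auto.
Qed.

Lemma attended_drop a agents agents' x S T :
  avoids a x S T -> incl agents (a :: agents') -> attended agents x S T ->
  attended agents' x S T.
Proof.
  intros Ha Hincl H u HS HT. destruct (H u HS HT) as [w [Hw [b [Hb E]]]].
  destruct (Hincl b Hb) as [<- | Hb'].
  - exfalso. apply (Ha w); [lra | exact E].
  - exists w. split; [exact Hw |]. exists b. auto.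
Qed.

Lemma lone_absence_brief a x S T : avoids a x S T -> attended [a] x S T -> T <= S + 1.
Proof.
  intros Ha H. apply Rnot_lt_le. intros Hlt.
  destruct (attended_drop a [a] [] x S T) with (u := T) as [w [_ [b [[] _]]]];
    auto with datatypes; lra.
Qed.

Lemma attended_subinterval agents x S T S' T' :
  S <= S' -> T' <= T -> attended agents x S T -> attended agents x S' T'.
Proof. intros HS HT H u Hu Hu'. apply H; lra. Qed.

(* A lone guard of [x] is never away from it for more than a unit of time. *)
Lemma lone_guard_avoids a x y d S T :
  attended [a] x S T -> S + 1 < T -> d <= Rabs (y - x) -> speed a / 2 < d ->
  avoids a y (S + 1 - d / speed a) (T - 1 + d / speed a).
Proof.
  intros H HST Hd Hhalf w Hw Haw.
  assert (/ 2 < d / speed a) by (apply Rlt_div_r; [apply speed_pos | lra]).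
  assert (Haway : avoids a x (w - d / speed a) (w + d / speed a))
    by (apply (avoids_distant a y); [exact Haw | rewrite Rabs_minus_sym; exact Hd]).
  set (S' := Rmax S (w - d / speed a)). set (T' := Rmin T (w + d / speed a)).
  assert (T' <= S' + 1).
  { apply (lone_absence_brief a x).
    - revert Haway. apply avoids_subinterval; [apply Rmax_r | apply Rmin_r].
    - revert H. apply attended_subinterval; [apply Rmax_l | apply Rmin_l]. }
  unfold S', T', Rmax, Rmin in *. repeat destruct Rle_dec; lra.
Qed.

Lemma lone_guard_avoids_distant a x y S T :
  attended [a] x S T -> S + 1 < T -> speed a / 2 < Rabs (y - x) ->
  avoids a y (S + / 2) (T - / 2).
Proof.
  intros H HST Hfar.
  assert (/ 2 < Rabs (y - x) / speed a) by (apply Rlt_div_r; [apply speed_pos | lra]).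
  eapply avoids_subinterval;
    [| | apply (lone_guard_avoids a x y _ S T H HST (Rle_refl _) Hfar)]; lra.
Qed.

(* While [a] is on its way from [x] to [y], [b] would be the lone guard of both. *)
Lemma transit_not_attended a b x y t u :
  transit a x y t u -> (speed a + speed b) / 2 < Rabs (y - x) ->
  attended [a; b] x t (u + Rabs (y - x) / speed a) ->
  attended [a; b] y (t - Rabs (y - x) / speed a) u -> False.
Proof.
  intros Htr Hlong Hx Hy. set (d := Rabs (y - x)) in *.
  pose proof (speed_pos a) as Ha. pose proof (speed_pos b) as Hb.
  assert (Hne : x <> y) by (intros ->; unfold d in Hlong; split_Rabs; lra).
  assert (/ 2 < d / speed a) by (apply Rlt_div_r; lra).
  assert (/ 2 < d / speed b) by (apply Rlt_div_r; lra).
  pose proof (half_sum_lt_travel_times Ha Hb Hlong).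
  pose proof (transit_duration Htr) as Hdur. fold d in Hdur.
  apply (attended_drop a _ [b]) in Hx;
    [| apply transit_avoids_start; auto | apply incl_refl].
  apply (attended_drop a _ [b]) in Hy;
    [| apply transit_avoids_end; auto | apply incl_refl].
  apply (lone_guard_avoids b x y d) in Hx; [| lra | apply Rle_refl | lra].
  set (S := Rmax (t - d / speed a) (t + 1 - d / speed b)).
  assert (u <= S + 1).
  { apply (lone_absence_brief b y).
    - revert Hx. apply avoids_subinterval; [apply Rmax_r | lra].
    - revert Hy. apply attended_subinterval; [apply Rmax_l | lra]. }
  unfold S, Rmax in *. destruct Rle_dec; lra.
Qed.

(* While [a] is away from [x0], [b] is bound to [x0], hence [a] to [x1], and
   nobody attends to [y]. *)
Lemma two_agents_absence_from_end a b x0 y x1 S T :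
  speed b / 2 < Rabs (y - x0) -> speed b / 2 < Rabs (x1 - x0) ->
  speed a / 2 < Rabs (y - x1) ->
  attended [a; b] x0 S T -> attended [a; b] y S T -> attended [a; b] x1 S T ->
  avoids a x0 S T -> T <= S + 3.
Proof.
  intros Hby Hb1 Hay H0 Hy H1 Ha. apply Rnot_lt_le. intros Hlt.
  apply (attended_drop a _ [b]) in H0; [| exact Ha | apply incl_refl].
  assert (Ha1 : attended [a] x1 (S + / 2) (T - / 2)).
  { apply (attended_drop b [a; b]).
    - apply (lone_guard_avoids_distant b x0); auto; lra.
    - intros c. simpl. tauto.
    - revert H1. apply attended_subinterval; lra. }
  assert (Hay' : avoids a y (S + / 2 + / 2) (T - / 2 - / 2))
    by (apply (lone_guard_avoids_distant a x1); auto; lra).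
  assert (T - 1 <= S + 1 + 1); [| lra].
  apply (lone_absence_brief b y).
  - apply avoids_subinterval with (S + / 2) (T - / 2); [lra | lra |].
    apply (lone_guard_avoids_distant b x0); auto; lra.
  - apply (attended_drop a [a; b]); [| apply incl_refl |].
    + revert Hay'. apply avoids_subinterval; lra.
    + revert Hy. apply attended_subinterval; lra.
Qed.

Lemma two_agents_visit_end a b x0 x1 S T :
  (speed a + speed b) / 2 < Rabs (x1 - x0) ->
  (forall x, between x0 x1 x -> attended [a; b] x S T) -> S + 3 < T ->
  exists w, S < w < T /\ a w = x0.
Proof.
  intros Hlong Hatt HST. apply NNPP. intros Hno.
  pose proof (speed_pos a). pose proof (speed_pos b).
  destruct (between_at_distance x0 x1
    ((speed b / 2 + (Rabs (x1 - x0) - speed a / 2)) / 2)) as [y [Hy [Hy0 Hy1]]]; [lra |].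
  assert (T <= S + 3); [| lra].
  apply (two_agents_absence_from_end a b x0 y x1).
  - lra.
  - lra.
  - rewrite Rabs_minus_sym. lra.
  - apply Hatt. auto.
  - apply Hatt, Hy.
  - apply Hatt. auto.
  - intros w Hw E. apply Hno. exists w. auto.
Qed.

Lemma two_agents_attend_briefly a b x0 x1 S T :
  (speed a + speed b) / 2 < Rabs (x1 - x0) ->
  (forall x, between x0 x1 x -> attended [a; b] x S T) ->
  T <= S + 8 + 2 * (Rabs (x1 - x0) / speed a).
Proof.
  intros Hlong Hatt. apply Rnot_lt_le. intros HT.
  pose proof (speed_pos a). pose proof (speed_pos b).
  set (r := Rabs (x1 - x0) / speed a) in *.
  assert (Hr : / 2 < r) by (apply Rlt_div_r; lra).
  destruct (two_agents_visit_end a b x0 x1 (S + r) (S + r + 4)) as [t [Ht Hat]];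
    [exact Hlong | | lra |].
  { intros x Hx. apply attended_subinterval with S T; [lra | lra | auto]. }
  destruct (two_agents_visit_end a b x1 x0 (S + r + 4) (S + r + 8)) as [u [Hu Hau]].
  - rewrite Rabs_minus_sym. exact Hlong.
  - intros x Hx. apply attended_subinterval with S T; [lra | lra |].
    apply Hatt, between_sym, Hx.
  - lra.
  - destruct (transit_exists a x0 x1 t u) as [t' [u' [Htr [Ht' Hu']]]];
      [lra | exact Hat | exact Hau | intros ->; split_Rabs; lra |].
    apply (transit_not_attended a b x0 x1 t' u' Htr Hlong); fold r;
      apply attended_subinterval with S T; try lra;
      apply Hatt; auto.
Qed.

(* The ends [x0] and [x1] come in either order, so that exchanging them takes the
   place of reflecting the fence. *)
Record patrolling (L x0 x1 : R) (F G M : agent) : Prop := {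
  fence_length : Rabs (x1 - x0) = L;
  fence_long : (speed F + speed G + speed M) / 2 < L;
  speed_G_le_F : speed G <= speed F;
  speed_M_le_F : speed M <= speed F;
  fence_attended : forall x S T, between x0 x1 x -> 0 <= S -> attended [F; G; M] x S T }.

Arguments fence_length {L x0 x1 F G M}.
Arguments fence_attended {L x0 x1 F G M}.

Lemma patrolling_swap {L x0 x1 F G M} :
  patrolling L x0 x1 F G M -> patrolling L x0 x1 F M G.
Proof.
  intros [HL Hlong HG HM Hatt]. constructor; auto; [lra |].
  intros x S T Hx HS. apply (attended_incl [F; G; M]); [| auto].
  intros a. simpl. tauto.
Qed.

Lemma patrolling_flip {L x0 x1 F G M} :
  patrolling L x0 x1 F G M -> patrolling L x1 x0 F G M.
Proof.
  intros [HL Hlong HG HM Hatt]. constructor; auto using between_sym.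
  rewrite Rabs_minus_sym. exact HL.
Qed.

Section Patrolling.
Context {L x0 x1 : R} {F G M : agent}.
Hypothesis P : patrolling L x0 x1 F G M.

Lemma ends_distinct : x0 <> x1.
Proof.
  destruct P as [HL Hlong _ _ _]. intros E. rewrite E in HL.
  pose proof (speed_pos F). pose proof (speed_pos G). pose proof (speed_pos M).
  split_Rabs; lra.
Qed.

Lemma fence_travel_times :
  / 2 < L / speed F /\ 1 < L / speed G /\ 2 < L / speed F + L / speed G.
Proof.
  destruct P as [_ Hlong HG HM _].
  pose proof (speed_pos F). pose proof (speed_pos G). pose proof (speed_pos M).
  repeat split; [apply Rlt_div_r; lra | apply Rlt_div_r; lra |].
  apply half_sum_lt_travel_times; lra.
Qed.

Lemma point_at_distance d :
  0 <= d <= L ->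
  exists y, between x0 x1 y /\ Rabs (y - x0) = d /\ Rabs (x1 - y) = L - d.
Proof. rewrite <- (fence_length P). apply between_at_distance. Qed.

Lemma lone_guard_M x S T :
  between x0 x1 x -> 0 <= S -> avoids F x S T -> avoids G x S T -> attended [M] x S T.
Proof.
  intros Hx HS HF HG.
  apply (attended_drop G [G; M]); [exact HG | apply incl_refl |].
  apply (attended_drop F [F; G; M]); [exact HF | apply incl_refl |].
  apply (fence_attended P); assumption.
Qed.

Lemma lone_guard_F x S T :
  between x0 x1 x -> 0 <= S -> avoids G x S T -> avoids M x S T -> attended [F] x S T.
Proof.
  intros Hx HS HG HM.
  apply (attended_drop M [M; F]); [exact HM | apply incl_refl |].
  apply (attended_drop G [F; G; M]); [exact HG | intros a; simpl; tauto |].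
  apply (fence_attended P); assumption.
Qed.

Lemma common_absence_brief x S T :
  between x0 x1 x -> 0 <= S -> avoids F x S T -> avoids G x S T -> avoids M x S T ->
  T <= S + 1.
Proof.
  intros Hx HS HF HG HM. apply (lone_absence_brief M x); auto using lone_guard_M.
Qed.

Lemma G_must_visit x S T :
  between x0 x1 x -> 0 <= S -> S + 1 < T -> avoids F x S T -> avoids M x S T ->
  exists w, S < w < T /\ G w = x.
Proof.
  intros Hx HS HST HF HM. apply NNPP. intros Hno.
  assert (T <= S + 1); [| lra]. apply (common_absence_brief x); auto.
  intros w Hw E. apply Hno. exists w. auto.
Qed.

Lemma lone_F_avoids y S T :
  / 2 <= S < T -> speed F / 2 < Rabs (x1 - y) ->
  avoids G x1 (S - / 2) (T + / 2) -> avoids M x1 (S - / 2) (T + / 2) -> avoids F y S T.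
Proof.
  intros HS Hy HG HM.
  apply avoids_subinterval with (S - / 2 + / 2) (T + / 2 - / 2); [lra | lra |].
  apply (lone_guard_avoids_distant F x1); [| lra | rewrite Rabs_minus_sym; exact Hy].
  apply lone_guard_F; auto. lra.
Qed.

(* At distance d from x0, where (g + m) / 2 < d < L - f / 2, the agents G and M
   are absent around s and p, and so is F, bound to x1. *)
Lemma slow_visits_far_apart s p :
  2 <= s -> 2 <= p -> G s = x0 -> M p = x0 -> p < s - 1 \/ s + 1 < p.
Proof.
  intros Hs Hp HGs HMp. apply NNPP. intros Hnear.
  assert (Hsp : s - 1 <= p <= s + 1) by lra. pose proof P as [HL Hlong HGF HMF _].
  pose proof (speed_pos F). pose proof (speed_pos G). pose proof (speed_pos M).
  set (d := ((speed G + speed M) / 2 + (L - speed F / 2)) / 2).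
  destruct (point_at_distance d) as [y [Hy [Hy0 Hy1]]]; [unfold d; lra |].
  assert (Hd : (speed G + speed M) / 2 < d < L - speed F / 2) by (unfold d; lra).
  assert (/ 2 < d / speed G) by (apply Rlt_div_r; lra).
  assert (/ 2 < d / speed M) by (apply Rlt_div_r; lra).
  pose proof (half_sum_lt_travel_times
    (d := d) (speed_pos G) (speed_pos M) ltac:(lra)).
  assert (Hbeyond : forall a, speed a <= speed F -> d / speed a + / 2 < L / speed a).
  { intros a Ha. pose proof (speed_pos a).
    replace (L / speed a) with (d / speed a + (L - d) / speed a) by (field; lra).
    apply Rplus_lt_compat_l, Rlt_div_r; lra. }
  pose proof (Hbeyond G HGF). pose proof (Hbeyond M HMF).
  set (S := Rmax (/ 2) (Rmax (s - d / speed G) (p - d / speed M))).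
  set (T := Rmin (s + d / speed G) (p + d / speed M)).
  assert (HS : / 2 <= S /\ s - d / speed G <= S /\ p - d / speed M <= S)
    by (unfold S, Rmax; repeat destruct Rle_dec; lra).
  assert (HT : T <= s + d / speed G /\ T <= p + d / speed M)
    by (split; [apply Rmin_l | apply Rmin_r]).
  assert (HST : S + 1 < T)
    by (unfold S, T, Rmax, Rmin; repeat destruct Rle_dec; lra).
  assert (T <= S + 1); [| lra].
  apply (common_absence_brief y);
    [exact Hy | lra | apply lone_F_avoids; [lra | lra | |] | |].
  - apply avoids_subinterval with (s - L / speed G) (s + L / speed G); [lra | lra |].
    apply (avoids_distant G x0); [exact HGs | lra].
  - apply avoids_subinterval with (p - L / speed M) (p + L / speed M); [lra | lra |].
    apply (avoids_distant M x0); [exact HMp | lra].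
  - apply avoids_subinterval with (s - d / speed G) (s + d / speed G); [lra | lra |].
    apply (avoids_distant G x0); [exact HGs | lra].
  - apply avoids_subinterval with (p - d / speed M) (p + d / speed M); [lra | lra |].
    apply (avoids_distant M x0); [exact HMp | lra].
Qed.

Lemma slow_visits_not_mixed S T s p :
  2 <= S -> avoids F x0 S T -> S < s -> s <= p -> p < T ->
  G s = x0 -> M p = x0 -> False.
Proof.
  intros HS HF Hs Hsp Hp HGs HMp.
  destruct (last_visit G x0 s p) as [s' [Hs' [HGs' Hlast]]]; [lra | exact HGs |].
  destruct (first_visit M x0 s' p) as [p' [Hp' [HMp' Hfirst]]]; [lra | exact HMp |].
  assert (p' <= s' + 1); [| destruct (slow_visits_far_apart s' p'); auto; lra].
  apply (common_absence_brief x0).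
  - auto.
  - lra.
  - revert HF. apply avoids_subinterval; lra.
  - intros w Hw. apply Hlast. lra.
  - intros w Hw. apply Hfirst. lra.
Qed.

(* While F and G are away from x0, M is bound to it, which leaves the part of
   the fence at distance more than m / 2 from x0 to F and G. *)
Lemma lone_M_guard_brief S T :
  0 <= S -> avoids F x0 S T -> avoids G x0 S T -> T <= S + 9 + 2 * (L / speed F).
Proof.
  intros HS HF HG. apply Rnot_lt_le. intros HT. pose proof P as [HL Hlong _ _ _].
  pose proof (speed_pos F). pose proof (speed_pos G). pose proof (speed_pos M).
  pose proof fence_travel_times as HLF.
  destruct (point_at_distance ((speed M / 2 + (L - (speed F + speed G) / 2)) / 2))
    as [y [Hy [Hy0 Hy1]]]; [lra |].
  assert (Rabs (x1 - y) / speed F <= L / speed F)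
    by (apply Rmult_le_compat_r; [apply Rlt_le, Rinv_0_lt_compat |]; lra).
  assert (T - / 2 <= S + / 2 + 8 + 2 * (Rabs (x1 - y) / speed F)); [| lra].
  apply (two_agents_attend_briefly F G y x1); [lra |].
  intros x Hx. destruct (between_subsegment Hy Hx) as [Hx' Hfar].
  apply (attended_drop M [F; G; M]); [| intros a; simpl; tauto |].
  - apply (lone_guard_avoids_distant M x0); [| lra | lra].
    apply lone_guard_M; auto.
  - apply (fence_attended P); [exact Hx' | lra].
Qed.

End Patrolling.

Lemma one_slow_visitor {L x0 x1 F G M} (P : patrolling L x0 x1 F G M) S T :
  2 <= S -> avoids F x0 S T -> avoids G x0 S T \/ avoids M x0 S T.
Proof.
  intros HS HF.
  destruct (classic (avoids G x0 S T)) as [HG | HG]; [left; exact HG |].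
  right. intros p Hp HMp. apply HG. intros s Hs HGs.
  destruct (Rle_lt_dec s p).
  - apply (slow_visits_not_mixed P S T s p); auto; lra.
  - apply (slow_visits_not_mixed (patrolling_swap P) S T p s); auto; lra.
Qed.

Lemma F_returns {L x0 x1 F G M} (P : patrolling L x0 x1 F G M) S :
  2 <= S -> exists w, S < w /\ F w = x0.
Proof.
  intros HS. apply NNPP. intros Hno.
  set (T := S + 10 + 2 * (L / speed F)).
  assert (HF : avoids F x0 S T)
    by (intros w Hw E; apply Hno; exists w; split; [lra | exact E]).
  assert (T <= S + 9 + 2 * (L / speed F)); [| unfold T in *; lra].
  destruct (one_slow_visitor P S T HS HF).
  - apply (lone_M_guard_brief P); auto; lra.
  - apply (lone_M_guard_brief (patrolling_swap P)); auto; lra.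
Qed.

Lemma transit_needs_both_slow {L x0 x1 F G M} (P : patrolling L x0 x1 F G M) t u :
  transit F x0 x1 t u -> L / speed F <= t ->
  avoids G x0 t (u + L / speed F) -> avoids G x1 (t - L / speed F) u -> False.
Proof.
  intros Htr Ht HG0 HG1.
  pose proof P as [HL Hlong _ _ _]. pose proof (speed_pos G).
  pose proof (fence_travel_times P).
  assert (HFM : forall x S T, between x0 x1 x -> 0 <= S -> avoids G x S T ->
    attended [F; M] x S T).
  { intros x S T Hx HS HG.
    apply (attended_drop G [F; G; M]); [exact HG | intros a; simpl; tauto |].
    apply (fence_attended P); assumption. }
  apply (transit_not_attended F M x0 x1 t u Htr); rewrite HL; [lra | |];
    apply HFM; auto; lra.
Qed.

Record excursion (a : agent) (x y t u u' t' : R) : Prop := {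
  excursion_out : transit a x y t u;
  excursion_stay : u <= u';
  excursion_back : transit a y x u' t';
  excursion_away : avoids a x t t' }.

Arguments excursion_stay {a x y t u u' t'}.
Arguments excursion_back {a x y t u u' t'}.

Lemma excursion_exists a x y t u t1 :
  transit a x y t u -> u <= t1 -> a t1 = x -> x <> y ->
  exists u' t', excursion a x y t u u' t'.
Proof.
  intros Hout Ht1 Hat1 Hxy. pose proof Hout as [Htu Hat Hau Hleaves _].
  destruct (first_visit a x u t1 Ht1 Hat1) as [t' [Ht' [Hat' Hfirst]]].
  destruct (last_visit a y u t') as [u' [Hu' [Hau' Hlast]]]; [lra | exact Hau |].
  assert (u' <> t') by congruence.
  exists u', t'. constructor; [exact Hout | lra | |].
  - constructor; auto; [lra | |]; intros w Hw; [apply Hlast | apply Hfirst]; lra.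
  - intros w Hw. destruct (Rlt_le_dec w u); [apply Hleaves | apply Hfirst]; lra.
Qed.

Lemma excursion_schedule {L x0 x1 F G M t u u' t'} (P : patrolling L x0 x1 F G M) :
  excursion F x0 x1 t u u' t' ->
  t + L / speed F <= u /\ u' + L / speed F <= t' /\
  avoids F x1 (t - L / speed F) u /\ avoids F x1 u' (t' + L / speed F).
Proof.
  intros [Hout _ Hback _]. pose proof (ends_distinct P) as Hne.
  pose proof (fence_length P) as HL.
  pose proof (fence_length (patrolling_flip P)) as HL'.
  rewrite <- HL at 1 3. rewrite <- HL'. split; [| split; [| split]].
  - apply transit_duration, Hout.
  - apply transit_duration, Hback.
  - apply transit_avoids_end; assumption.
  - apply transit_avoids_start; auto.
Qed.

Lemma guard_avoids_other_end {L x0 x1 F G M t u u' t'} (P : patrolling L x0 x1 F G M) :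
  excursion F x0 x1 t u u' t' -> 2 + L / speed F <= t -> avoids G x0 t t' ->
  avoids M x1 (t - L / speed F) (t' + L / speed F).
Proof.
  intros E Ht HG. pose proof E as [Hout Hstay Hback Haway].
  destruct (excursion_schedule P E) as [Dout [Dback [Fout Fback]]].
  pose proof (fence_travel_times P). pose proof (fence_travel_times (patrolling_swap P)).
  assert (Mout : avoids M x1 (t - L / speed F) u).
  { destruct (one_slow_visitor (patrolling_flip P) (t - L / speed F) u) as [G1 | M1];
      [lra | exact Fout | exfalso | exact M1].
    apply (transit_needs_both_slow P t u); [exact Hout | lra | | exact G1].
    revert HG. apply avoids_subinterval; lra. }
  assert (Mback : avoids M x1 u' (t' + L / speed F)).
  { destruct (one_slow_visitor (patrolling_flip P) u' (t' + L / speed F)) as [G1 | M1];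
      [lra | exact Fback | exfalso | exact M1].
    apply (transit_needs_both_slow (patrolling_flip P) u' t');
      [exact Hback | lra | exact G1 |].
    revert HG. apply avoids_subinterval; lra. }
  assert (Mstay : avoids M x1 (t + 1 - L / speed M) (t' - 1 + L / speed M)).
  { pose proof P as [HL Hlong _ _ _].
    pose proof (speed_pos F). pose proof (speed_pos G). pose proof (speed_pos M).
    apply (lone_guard_avoids M x0); [| lra | lra | lra].
    apply (lone_guard_M P); auto; lra. }
  refine (avoids_overlap (avoids_overlap Mout Mstay _) Mback _); lra.
Qed.

(* F stands in for G at [x]: G leaves at [r] and is back at [s], and [u] and [v]
   are visits of F. *)
Record relief (F G : agent) (x u v r s : R) : Prop := {
  relief_begins : u - 1 <= r <= u;
  relief_lasts : u <= v;
  relief_ends : v <= s <= v + 1;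
  relief_F_u : F u = x;
  relief_F_v : F v = x;
  relief_G_r : G r = x;
  relief_G_s : G s = x;
  relief_attended : attended [F] x r s }.

Arguments relief_lasts {F G x u v r s}.
Arguments relief_attended {F G x u v r s}.

Lemma relief_exists {L x0 x1 F G M t u u' t'} (P : patrolling L x0 x1 F G M) :
  excursion F x0 x1 t u u' t' -> L / speed F <= t ->
  avoids M x1 (t - L / speed F) (t' + L / speed F) ->
  exists v r s, relief F G x1 u v r s /\ v <= u'.
Proof.
  intros E Ht HM.
  destruct (excursion_schedule P E) as [Dout [Dback [Fout Fback]]].
  destruct E as [[Htu _ HFu _ _] Hstay _ _].
  pose proof (fence_travel_times P).
  assert (HM' : forall S T,
    t - L / speed F <= S -> T <= t' + L / speed F -> avoids M x1 S T)
    by (intros S T HS HT; revert HM; apply avoids_subinterval; assumption).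
  destruct (G_must_visit P x1 (t - L / speed F) u) as [w [Hw HGw]]; auto;
    [lra | lra | apply HM'; lra |].
  destruct (last_visit G x1 w u) as [r [Hr [HGr Hlast]]]; [lra | exact HGw |].
  destruct (G_must_visit P x1 u' (t' + L / speed F)) as [w' [Hw' HGw']]; auto;
    [lra | lra | apply HM'; lra |].
  destruct (first_visit G x1 u w') as [s [Hs [HGs Hfirst]]]; [lra | exact HGw' |].
  destruct (last_visit F x1 u s) as [v [Hv [HFv Hlast']]]; [lra | exact HFu |].
  exists v, r, s. split.
  - constructor; auto; [split; [| lra] | lra | split; [lra |] |].
    + assert (u <= r + 1); [| lra].
      apply (common_absence_brief P x1); auto; [lra | | | apply HM'; lra].
      * revert Fout. apply avoids_subinterval; lra.
      * intros z Hz. apply Hlast. lra.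
    + apply (common_absence_brief P x1); auto; [lra | | | apply HM'; lra].
      * intros z Hz. apply Hlast'. lra.
      * intros z Hz. apply Hfirst. lra.
    + apply (lone_guard_F P); auto; [lra | | apply HM'; lra].
      intros z Hz. destruct (Rle_lt_dec z u); [apply Hlast | apply Hfirst]; lra.
  - apply Rnot_lt_le. intros Hlt. apply (Fback v); [lra | exact HFv].
Qed.

Lemma relief_F_avoids {F G x y d u v r s} :
  relief F G x u v r s -> d <= Rabs (y - x) -> speed F / 2 < d ->
  avoids F y (u - d / speed F) (v + d / speed F).
Proof.
  intros [Hr Huv Hs HFu HFv _ _ Hatt] Hd Hhalf.
  assert (/ 2 < d / speed F) by (apply Rlt_div_r; [apply speed_pos | lra]).
  pose proof (avoids_distant F x y d u HFu Hd) as Hu.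
  pose proof (avoids_distant F x y d v HFv Hd) as Hv.
  destruct (Rle_lt_dec s (r + 1)) as [Hshort | Hlong].
  - refine (avoids_overlap Hu Hv _). lra.
  - pose proof (lone_guard_avoids F x y d r s Hatt Hlong Hd Hhalf) as Hrs.
    refine (avoids_overlap (avoids_overlap Hu Hrs _) Hv _); lra.
Qed.

Lemma relief_G_away {F G x y d u v r s w} :
  relief F G x u v r s -> speed G <= speed F -> 0 <= d <= Rabs (y - x) ->
  u - d / speed F < w < v + d / speed F -> G w = y ->
  r + d / speed G <= w <= s - d / speed G.
Proof.
  intros [Hr Huv Hs _ _ HGr HGs _] Hslow [Hd0 Hd] Hw HGw.
  assert (d / speed F <= d / speed G).
  { apply Rmult_le_compat_l; [exact Hd0 |].
    apply Rinv_le_contravar; [apply speed_pos | exact Hslow]. }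
  split; apply Rnot_lt_le; intros Hlt.
  - apply (avoids_distant G x y d r HGr Hd w); [lra | exact HGw].
  - apply (avoids_distant G x y d s HGs Hd w); [lra | exact HGw].
Qed.

Lemma travel_times_gt_4 f g m L :
  0 < m -> m <= g -> 2 * g < f -> (f + g + m) / 2 < L ->
  4 < (2 * L) / f + (2 * (L - m)) / g.
Proof.
  intros Hm Hmg Hgf HL. apply lt_div_add_div; [lra | lra |].
  assert (0 <= (f - g) * (f - g - m)) by (apply Rmult_le_pos; lra).
  assert (0 < (f + g) * (L - (f + g + m) / 2)) by (apply Rmult_lt_0_compat; lra).
  nra.
Qed.

Lemma travel_times_gt_7_div_2 f g m e L :
  0 < m -> m <= g -> 2 * g < f -> 0 < e -> (f + g + m) / 2 + e < L ->
  7 / 2 < (2 * L - m / 2 - e) / f + (2 * (L - m)) / g.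
Proof.
  intros Hm Hmg Hgf He HL. apply lt_div_add_div; [lra | lra |].
  assert (0 <= (2 * f - 3 * g) * (f - g)) by (apply Rmult_le_pos; lra).
  assert (0 <= (g - m) * (2 * f - g)) by (apply Rmult_le_pos; lra).
  assert (0 < (f + g) * (L - (f + g + m) / 2 - e)) by (apply Rmult_lt_0_compat; lra).
  nra.
Qed.

Lemma travel_times_gt_add_2 f g m e tau L :
  0 < m -> m <= g -> g <= f -> 0 < e -> tau < 2 -> (f + g + m) / 2 + e < L ->
  tau + 2 < (2 * L) / f + (2 * (L - (m * (3 - tau) / 2 + e))) / g.
Proof.
  intros Hm Hmg Hgf He Htau HL. apply lt_div_add_div; [lra | lra |].
  assert (0 <= (2 - tau) * f * (g - m))
    by (apply Rmult_le_pos; [apply Rmult_le_pos |]; lra).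
  pose proof (pow2_ge_0 (f - g)).
  assert (0 < (f + g) * (L - (f + g + m) / 2 - e)) by (apply Rmult_lt_0_compat; lra).
  nra.
Qed.

Section GuardRelief.
Context {L x0 x1 t t' u v r s : R} {F G M : agent}.
Hypothesis P : patrolling L x0 x1 F G M.
Hypothesis speed_M_le_G : speed M <= speed G.
Hypothesis M_guards : attended [M] x0 t t'.
Hypothesis F_relieves_G : relief F G x1 u v r s.
Hypothesis t_nonneg : 0 <= t.
Hypothesis F_arrives : t + L / speed F <= u.
Hypothesis F_departs : v + L / speed F <= t'.

Lemma excursion_gt_1 : t + 1 < t'.
Proof.
  pose proof (fence_travel_times P). pose proof (relief_lasts F_relieves_G). lra.
Qed.

Lemma M_avoids y d :
  Rabs (y - x0) = d -> speed M / 2 < d ->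
  avoids M y (t + 1 - d / speed M) (t' - 1 + d / speed M).
Proof.
  intros Hd Hhalf. apply (lone_guard_avoids M x0); [exact M_guards | | lra | exact Hhalf].
  exact excursion_gt_1.
Qed.

(* Under the last two hypotheses the absences of F and M from [y] overlap for
   more than a unit of time. *)
Lemma G_visits_abandoned y d :
  between x0 x1 y -> Rabs (y - x0) = d -> Rabs (x1 - y) = L - d ->
  speed M / 2 < d -> speed F / 2 < L - d ->
  3 < t' - t + 2 * (d / speed M) ->
  2 < L / speed F + (v - u) + d / speed M + (L - d) / speed F ->
  exists w, t + 1 - d / speed M < w < t' - 1 + d / speed M /\
    r + (L - d) / speed G <= w <= s - (L - d) / speed G /\ G w = y.
Proof.
  intros Hy Hd HLd HMd HFd HM HF. pose proof P as [_ _ HGF _ _].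
  pose proof (speed_pos F). pose proof (speed_pos M).
  pose proof (fence_travel_times P).
  assert (/ 2 < (L - d) / speed F) by (apply Rlt_div_r; lra).
  assert ((L - d) / speed F <= L / speed F)
    by (apply Rmult_le_compat_r; [apply Rlt_le, Rinv_0_lt_compat |]; lra).
  pose proof (relief_lasts F_relieves_G).
  assert (Hx1y : L - d <= Rabs (y - x1)) by (rewrite Rabs_minus_sym; lra).
  pose proof (relief_F_avoids F_relieves_G Hx1y HFd) as Fy.
  set (S := Rmax (t + 1 - d / speed M) (u - (L - d) / speed F)).
  set (T := Rmin (t' - 1 + d / speed M) (v + (L - d) / speed F)).
  assert (HS : t + 1 - d / speed M <= S /\ u - (L - d) / speed F <= S)
    by (split; [apply Rmax_l | apply Rmax_r]).
  assert (HT : T <= t' - 1 + d / speed M /\ T <= v + (L - d) / speed F)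
    by (split; [apply Rmin_l | apply Rmin_r]).
  assert (HST : S + 1 < T)
    by (unfold S, T, Rmax, Rmin; repeat destruct Rle_dec; lra).
  destruct (G_must_visit P y S T) as [w [Hw HGw]]; [exact Hy | lra | exact HST | | |].
  - revert Fy. apply avoids_subinterval; lra.
  - apply avoids_subinterval with (3 := M_avoids y d Hd HMd); lra.
  - exists w. split; [lra |]. split; [| exact HGw].
    apply (relief_G_away (y := y) F_relieves_G); auto; lra.
Qed.

Lemma relief_long d :
  speed M / 2 < d -> speed F / 2 < L - d ->
  3 < t' - t + 2 * (d / speed M) ->
  2 < L / speed F + (v - u) + d / speed M + (L - d) / speed F ->
  2 * (L - d) / speed G <= v - u + 2.
Proof.
  intros HMd HFd HM HF. pose proof (speed_pos F). pose proof (speed_pos M).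
  destruct (point_at_distance P d) as [y [Hy [Hd HLd]]]; [lra |].
  destruct (G_visits_abandoned y d) as [w [_ [Hw _]]]; auto.
  destruct F_relieves_G as [Hr _ Hs _ _ _ _ _].
  replace (2 * (L - d) / speed G) with (2 * ((L - d) / speed G)) by (unfold Rdiv; ring).
  lra.
Qed.

Lemma relief_long_slow_G :
  2 * speed G < speed F -> 2 * (L - speed M) / speed G <= v - u + 2.
Proof.
  intros Hslow. pose proof P as [_ Hlong _ _ _].
  pose proof (speed_pos F). pose proof (speed_pos M).
  pose proof (relief_lasts F_relieves_G). pose proof excursion_gt_1.
  assert (E : speed M / speed M = 1) by (field; lra).
  apply relief_long; rewrite ?E; [lra | lra | lra |].
  assert (1 < (2 * L - speed M) / speed F) by (apply Rlt_div_r; lra).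
  replace ((L - speed M) / speed F) with ((2 * L - speed M) / speed F - L / speed F)
    by (field; lra).
  lra.
Qed.

Lemma excursion_ge_2 : 2 <= t' - t.
Proof.
  apply Rnot_lt_le. intros Hshort. pose proof P as [_ Hlong HGF _ _].
  pose proof (speed_pos F). pose proof (speed_pos G). pose proof (speed_pos M).
  pose proof excursion_gt_1. pose proof (relief_lasts F_relieves_G).
  assert (Htwice : 2 * L / speed F = L / speed F + L / speed F) by (field; lra).
  destruct (Rlt_le_dec (2 * speed G) (speed F)) as [Hslow | Hfast].
  - pose proof (relief_long_slow_G Hslow).
    pose proof (travel_times_gt_4 _ _ _ L (speed_pos M) speed_M_le_G Hslow Hlong). lra.
  - set (tau := t' - t) in *.
    set (e := (L - (speed F + speed G + speed M) / 2) / 4).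
    (* At distance [d] the absence of M lasts barely more than a unit of time. *)
    set (d := speed M * (3 - tau) / 2 + e).
    assert (Hd : d / speed M = (3 - tau) / 2 + e / speed M) by (unfold d; field; lra).
    assert (He : 0 < e / speed M) by (apply Rdiv_lt_0_compat; unfold e; lra).
    assert (0 < speed M * (2 - tau)) by (apply Rmult_lt_0_compat; lra).
    assert (0 < speed M * (tau - 1)) by (apply Rmult_lt_0_compat; unfold tau; lra).
    assert (0 < speed F * (2 - tau)) by (apply Rmult_lt_0_compat; lra).
    assert (2 * (L - d) / speed G <= v - u + 2).
    { apply relief_long; [unfold d, e; lra | unfold d, e; lra | fold tau; lra |].
      assert ((1 + tau) / 2 < (2 * L - d) / speed F)
        by (apply -> Rlt_div_r; [unfold d, e |]; lra).
      replace ((L - d) / speed F) with ((2 * L - d) / speed F - L / speed F)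
        by (field; lra).
      lra. }
    assert (tau + 2 < 2 * L / speed F + 2 * (L - d) / speed G)
      by (apply travel_times_gt_add_2; auto; unfold e; lra).
    unfold tau in *. lra.
Qed.

(* While G is at distance m / 2 + e from x0, M is bound to x0 and F to x1, and
   the point at distance (g + m) / 2 + 2 e from x0 is left alone. *)
Lemma G_not_at_near_point e w y :
  0 < e -> (speed F + speed G + speed M) / 2 + 2 * e < L ->
  Rabs (y - x0) = speed M / 2 + e -> G w = y ->
  t + 1 - (speed M / 2 + e) / speed M < w < t' - 1 + (speed M / 2 + e) / speed M ->
  r + (L - (speed M / 2 + e)) / speed G <= w <= s - (L - (speed M / 2 + e)) / speed G ->
  False.
Proof.
  intros He HeL Hy HGw HMw HGw'. pose proof P as [_ _ HGF _ _].
  pose proof (speed_pos F). pose proof (speed_pos G). pose proof (speed_pos M).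
  set (d := (speed G + speed M) / 2 + 2 * e).
  destruct (point_at_distance P d) as [z [Hz [Hz0 Hz1]]]; [unfold d; lra |].
  assert (Hyz : speed G / 2 + e <= Rabs (z - y)) by (unfold d in *; split_Rabs; lra).
  set (eta := e / speed G).
  assert (Heta : 0 < eta) by (apply Rdiv_lt_0_compat; lra).
  assert (HetaM : eta <= e / speed M).
  { apply Rmult_le_compat_l; [lra |]. apply Rinv_le_contravar; lra. }
  assert (EG : (speed G / 2 + e) / speed G = / 2 + eta) by (unfold eta; field; lra).
  assert (EM : (speed M / 2 + e) / speed M = / 2 + e / speed M) by (field; lra).
  assert (DM : 1 + 2 * (e / speed M) <= d / speed M).
  { replace (1 + 2 * (e / speed M)) with ((speed M + 2 * e) / speed M) by (field; lra).
    apply Rmult_le_compat_r; [apply Rlt_le, Rinv_0_lt_compat |]; unfold d; lra. }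
  assert (DG : 1 + eta < (L - (speed M / 2 + e)) / speed G).
  { replace (1 + eta) with ((speed G + e) / speed G) by (unfold eta; field; lra).
    apply Rmult_lt_compat_r; [apply Rinv_0_lt_compat |]; lra. }
  assert (Hrs : attended [F] x1 r s) by apply (relief_attended F_relieves_G).
  destruct F_relieves_G as [Hr _ _ _ _ _ _ _].
  pose proof (fence_travel_times P).
  assert (w + / 2 + eta <= w - / 2 - eta + 1); [| lra].
  apply (common_absence_brief P z); [exact Hz | lra | | |].
  - apply avoids_subinterval with (r + / 2) (s - / 2); [lra | lra |].
    apply (lone_guard_avoids_distant F x1); [exact Hrs | lra |].
    rewrite Rabs_minus_sym. unfold d in *. lra.
  - apply avoids_subinterval with (3 := avoids_distant G y z _ w HGw Hyz); lra.
  - apply avoids_subinterval with (3 := M_avoids z d Hz0 ltac:(unfold d; lra)); lra.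
Qed.

Lemma relief_impossible : False.
Proof.
  pose proof P as [_ Hlong HGF _ _].
  pose proof (speed_pos F). pose proof (speed_pos G). pose proof (speed_pos M).
  pose proof (relief_lasts F_relieves_G). pose proof excursion_ge_2.
  set (e := (L - (speed F + speed G + speed M) / 2) / 4).
  set (d := speed M / 2 + e).
  assert (He : 0 < e / speed M) by (apply Rdiv_lt_0_compat; unfold e; lra).
  assert (Hd : d / speed M = / 2 + e / speed M) by (unfold d; field; lra).
  destruct (point_at_distance P d) as [y [Hy [Hy0 Hy1]]]; [unfold d, e; lra |].
  assert (Hvu : 3 / 2 <= (2 * L - d) / speed F + (v - u)).
  { destruct (Rlt_le_dec (2 * speed G) (speed F)) as [Hslow | Hfast].
    - pose proof (relief_long_slow_G Hslow).
      pose proof (travel_times_gt_7_div_2 (speed F) (speed G) (speed M) e L) as Hnear.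
      replace (2 * L - d) with (2 * L - speed M / 2 - e) by (unfold d; ring).
      unfold e in *. lra.
    - assert (3 / 2 < (2 * L - d) / speed F)
        by (apply -> Rlt_div_r; [unfold d, e |]; lra).
      lra. }
  destruct (G_visits_abandoned y d) as [w [HMw [HGw E]]];
    [exact Hy | exact Hy0 | exact Hy1 | unfold d, e; lra | unfold d, e; lra | lra | |].
  - replace ((L - d) / speed F) with ((2 * L - d) / speed F - L / speed F)
      by (field; lra).
    lra.
  - apply (G_not_at_near_point e w y); auto; unfold e; lra.
Qed.

End GuardRelief.

Lemma excursion_guards {L x0 x1 F G M t u u' t'} (P : patrolling L x0 x1 F G M) :
  speed M <= speed G -> excursion F x0 x1 t u u' t' -> 2 + L / speed F <= t ->
  avoids M x0 t t' /\ avoids G x1 (t - L / speed F) (t' + L / speed F).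
Proof.
  intros HMG E Ht. pose proof E as [_ _ _ HF].
  pose proof (fence_travel_times P).
  destruct (one_slow_visitor P t t') as [HG | HM]; [lra | exact HF | exfalso |].
  - destruct (excursion_schedule P E) as [Dout [Dback _]].
    pose proof (guard_avoids_other_end P E Ht HG) as HM.
    destruct (relief_exists P E) as [v [r [s [Hrel Hv]]]]; [lra | exact HM |].
    apply (relief_impossible (t := t) (t' := t') P HMG) with (2 := Hrel); try lra.
    apply (lone_guard_M P); auto; lra.
  - split; [exact HM |].
    exact (guard_avoids_other_end (patrolling_swap P) E Ht HM).
Qed.

Lemma not_patrolling L x0 x1 F G M :
  speed M <= speed G -> ~ patrolling L x0 x1 F G M.
Proof.
  intros HMG P. pose proof (patrolling_flip P) as P'.
  pose proof (ends_distinct P) as Hne. pose proof (fence_travel_times P).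
  destruct (F_returns P (2 + L / speed F)) as [t0 [Ht0 HF0]]; [lra |].
  destruct (F_returns P' t0) as [u0 [Hu0 HFu0]]; [lra |].
  destruct (F_returns P u0) as [t1 [Ht1 HF1]]; [lra |].
  destruct (transit_exists F x0 x1 t0 u0) as [t [u [Hout [Ht Hu]]]]; auto; [lra |].
  destruct (excursion_exists F x0 x1 t u t1 Hout) as [u' [t' E]]; auto; [lra |].
  destruct (F_returns P' t') as [u1 [Hu1 HFu1]].
  { destruct Hout, E as [_ ? [? _ _ _ _] _]. lra. }
  destruct (excursion_exists F x1 x0 u' t' u1 (excursion_back E))
    as [q [s' E']]; auto; [lra |].
  destruct (excursion_guards P HMG E) as [_ HG]; [lra |].
  destruct (excursion_schedule P E) as [Dout [Dback [_ HF]]].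
  destruct (excursion_schedule P' E') as [_ [Dback' _]].
  pose proof (excursion_stay E). pose proof (excursion_stay E').
  destruct (excursion_guards P' HMG E') as [HM _]; [lra |].
  assert (t' + L / speed F <= u' + 1); [| lra].
  apply (common_absence_brief P x1); auto; [lra | |].
  - revert HG. apply avoids_subinterval; lra.
  - revert HM. apply avoids_subinterval; lra.
Qed.

Lemma sort_agents a b c :
  exists F G M, speed M <= speed G <= speed F /\ incl [a; b; c] [F; G; M] /\
    speed F + speed G + speed M = speed a + speed b + speed c.
Proof.
  destruct (Rle_lt_dec (speed a) (speed b)), (Rle_lt_dec (speed b) (speed c)),
    (Rle_lt_dec (speed a) (speed c));
    [ exists c, b, a | exists c, b, a | exists b, c, a | exists b, a, c
    | exists c, a, b | exists a, c, b | exists a, b, c | exists a, b, c ];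
    (split; [lra | split; [intros d; simpl; tauto | ring]]).
Qed.

Lemma three_agents_cannot_attend a b c l :
  (speed a + speed b + speed c) / 2 < l ->
  ~ (forall x S T, 0 <= x <= l -> 0 <= S -> attended [a; b; c] x S T).
Proof.
  intros Hl Hatt. destruct (sort_agents a b c) as [F [G [M [Hsorted [Hincl Hsum]]]]].
  pose proof (speed_pos a). pose proof (speed_pos b). pose proof (speed_pos c).
  apply (not_patrolling l 0 l F G M); [lra |].
  constructor; [rewrite Rabs_right; lra | lra | lra | lra |].
  intros x S T Hx HS. apply (attended_incl [a; b; c]); [exact Hincl |].
  apply Hatt; [unfold between in Hx |]; lra.
Qed.

Lemma motion_lipschitz l v p s t :
  0 < v -> motion l v p -> 0 <= s -> 0 <= t -> Rabs (p s - p t) <= v * Rabs (s - t).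
Proof.
  intros Hv [_ H] Hs Ht.
  assert (Hle : forall s t, 0 <= s <= t -> Rabs (p s - p t) <= v * (t - s)).
  { clear s t Hs Ht. intros s t [Hs [Hst | ->]].
    - replace (p t) with (p (s + (t - s))) by (f_equal; ring). apply H; lra.
    - rewrite Rminus_diag, Rabs_R0. lra. }
  destruct (Rle_lt_dec s t).
  - rewrite (Rabs_left1 (s - t)), Ropp_minus_distr by lra. apply Hle. lra.
  - rewrite Rabs_minus_sym, (Rabs_right (s - t)) by lra. apply Hle. lra.
Qed.

Lemma motion_agent l v p :
  0 < v -> motion l v p ->
  exists a : agent, speed a = v /\ forall t, 0 <= t -> a t = p t.
Proof.
  intros Hv Hp.
  assert (Hext : forall s t, Rabs (p (Rmax s 0) - p (Rmax t 0)) <= v * Rabs (s - t)).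
  { intros s t.
    apply Rle_trans with (v * Rabs (Rmax s 0 - Rmax t 0)).
    - apply (motion_lipschitz l); auto using Rmax_r.
    - apply Rmult_le_compat_l; [lra |].
      unfold Rmax; repeat destruct Rle_dec; split_Rabs; lra. }
  exists {| position := fun t => p (Rmax t 0); speed := v; speed_pos := Hv;
    speed_limit := Hext |}.
  split; [reflexivity |]. intros t Ht. simpl. rewrite Rmax_left by lra. reflexivity.
Qed.

Theorem theorem4 (v : nat -> R) (l : R) :
  0 < v 0%nat -> 0 < v 1%nat -> 0 < v 2%nat ->
  l > (v 0%nat + v 1%nat + v 2%nat) / 2 ->
  ~ exists a : nat -> R -> R, strategy 3 l v a /\ patrols 3 l a.
Proof.
  intros V0 V1 V2 Hl [p [Hs Hp]].
  destruct (motion_agent l _ _ V0 (Hs 0%nat ltac:(lia))) as [a [Ha Ea]].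
  destruct (motion_agent l _ _ V1 (Hs 1%nat ltac:(lia))) as [b [Hb Eb]].
  destruct (motion_agent l _ _ V2 (Hs 2%nat ltac:(lia))) as [c [Hc Ec]].
  apply (three_agents_cannot_attend a b c l); [lra |].
  intros x S T Hx HS u Hu _.
  destruct (Hp x u) as [i [Hi [w [Hw E]]]]; [exact Hx | lra |].
  exists w. split; [exact Hw |].
  destruct i as [| [| [| i]]].
  - exists a. rewrite Ea by lra. simpl. auto.
  - exists b. rewrite Eb by lra. simpl. auto.
  - exists c. rewrite Ec by lra. simpl. auto.
  - exfalso. lia.
Qed.
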